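(* Let $\Gamma=\mathfrak g_{-1}\oplus\mathfrak g_0\oplus\mathfrak g_1$ be a local Lie algebra over $\mathbb C$, and write $\mathfrak g_{min}(\Gamma)=\bigoplus_{i\in\mathbb Z}(\mathfrak g_{min}(\Gamma))_i$ for the grading of the minimal graded Lie algebra with local part $\Gamma$. For $n\ge 2$ let $\mathcal P_n$ be the universal Lie polynomial described in the context. 1) Let $n\ge 2$. The following conditions are equivalent: (a) $(\mathfrak g_{min}(\Gamma))_i=\{0\}$ for all $i\ge n$; (b) the identity $\mathcal P_n(Y_1,\dots,Y_{n-1},X_1,\dots,X_n)=0$ holds in $\Gamma$ for all $X_1,\dots,X_n\in\mathfrak g_1$ and all $Y_1,\dots,Y_{n-1}\in\mathfrak g_{-1}$. 2) Let $n\ge 2$. The following conditions are equivalent: (a) $(\mathfrak g_{min}(\Gamma))_i=\{0\}$ for all $i\le -n$; (b) the identity $\mathcal P_n(X_1,\dots,X_{n-1},Y_1,\dots,Y_n)=0$ holds in $\Gamma$ for all $X_1,\dots,X_{n-1}\in\mathfrak g_1$ and all $Y_1,\dots,Y_n\in\mathfrak g_{-1}$. 3) $\dim\mathfrak g_{min}(\Gamma)<+\infty$ if and only if there exist integers $m,n\ge 2$ such that the identities $\mathcal P_m(Y_1,\dots,Y_{m-1},X_1,\dots,X_m)=0$ and $\mathcal P_n(X_1,\dots,X_{n-1},Y_1,\dots,Y_n)=0$ hold in $\Gamma$ for all $X_i\in\mathfrak g_1$ and all $Y_j\in\mathfrak g_{-1}$.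
   Context: All vector spaces and Lie algebras are over $\mathbb C$. A graded Lie algebra is a Lie algebra $\mathfrak g=\bigoplus_{i\in\mathbb Z}\mathfrak g_i$ with $\dim\mathfrak g_i<\infty$, $[\mathfrak g_i,\mathfrak g_j]\subset\mathfrak g_{i+j}$, generated by its local part $\Gamma(\mathfrak g)=\mathfrak g_{-1}\oplus\mathfrak g_0\oplus\mathfrak g_1$. A local Lie algebra is a direct sum $\Gamma=\mathfrak g_{-1}\oplus\mathfrak g_0\oplus\mathfrak g_1$ of finite-dimensional spaces with bilinear anticommutative brackets $\mathfrak g_i\times\mathfrak g_j\to\mathfrak g_{i+j}$ for $i,j\in\{-1,0,1\}$ with $|i+j|\le 1$, such that the Jacobi identity $[x,[y,z]]=[[x,y],z]+[y,[x,z]]$ holds each time its three terms are defined. Morphisms of graded (resp. local) Lie algebras are degree-preserving linear maps compatible with all (defined) brackets. By a theorem of Kac, for every local Lie algebra $\Gamma$ there is a unique graded Lie algebra $\mathfrak g_{max}(\Gamma)$ with local part $\Gamma$ such that every morphism of local Lie algebras from $\Gamma$ to the local part of a graded Lie algebra $\mathfrak g$ extends uniquely to a morphism of graded Lie algebras $\mathfrak g_{max}(\Gamma)\to\mathfrak g$. It has a unique maximal graded ideal $J_{max}$ with $J_{max}\cap\Gamma=\{0\}$, and $\mathfrak g_{min}(\Gamma):=\mathfrak g_{max}(\Gamma)/J_{max}$, which has local part $\Gamma$. The polynomial $\mathcal P_n$: for $n\ge2$, in the free Lie algebra on the $2n-1$ variables $Y_1,\dots,Y_{n-1},X_1,\dots,X_n$,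 the Lie monomial $[Y_1,[Y_2,[\dots,[Y_{n-1},[X_1,[\dots,[X_{n-1},X_n]\dots]$ is equal to a linear combination $\mathcal P_n(Y_1,\dots,Y_{n-1},X_1,\dots,X_n)=\sum_\alpha U_\alpha$ of Lie monomials $U_\alpha$ each of which makes sense in any local Lie algebra when $X_i\in\mathfrak g_1$ and $Y_j\in\mathfrak g_{-1}$ (i.e., giving each $X_i$ degree $1$ and each $Y_j$ degree $-1$, every iterated sub-bracket of $U_\alpha$ has degree in $\{-1,0,1\}$, so $U_\alpha$ can be evaluated using only the partial brackets of the local Lie algebra). Fix such an expression $\mathcal P_n$ for each $n$; for example $\mathcal P_2(Y,X_1,X_2)=[[Y,X_1],X_2]+[X_1,[Y,X_2]]$. The notation $\mathcal P_n(X_1,\dots,X_{n-1},Y_1,\dots,Y_n)$ means the same expression with the roles of $\mathfrak g_1$ and $\mathfrak g_{-1}$ exchanged (elements of $\mathfrak g_1$ are substituted for the first $n-1$ variables and elements of $\mathfrak g_{-1}$ for the last $n$). *)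

(* Defs.v *)
From HB Require Import structures.
From mathcomp Require Import all_boot all_order all_algebra.
From mathcomp Require Import complex reals.

Set Implicit Arguments.
Unset Strict Implicit.
Unset Printing Implicit Defensive.

Import Order.TTheory GRing.Theory Num.Theory.
Local Open Scope ring_scope.

Definition local_degree (i : int) : bool := `|i| <= 1.

(* The partial brackets g_i x g_j -> g_(i+j), |i+j| <= 1, are extended by zero
   to a bilinear bracket on g_(-1) + g_0 + g_1: since [lla_gr i = 0] for
   |i| > 1, [lla_br_gr] says exactly that the brackets which are not part of
   the data vanish.  The Jacobi identity is required only when its three terms
   involve no such bracket. *)
Record localLieAlgebra (K : fieldType) : Type := LocalLieAlgebra {
  lla_car :> vectType K;
  lla_gr : int -> {vspace lla_car};
  lla_br : lla_car -> lla_car -> lla_car;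
  lla_gr_out : forall i, ~~ local_degree i -> lla_gr i = 0%VS;
  lla_gr_sum : (lla_gr (- 1) + lla_gr 0 + lla_gr 1)%VS = fullv;
  lla_gr_direct : directv (lla_gr (- 1) + lla_gr 0 + lla_gr 1)%VS;
  lla_br_linearl : forall y, linear (fun x => lla_br x y);
  lla_br_linearr : forall x, linear (lla_br x);
  lla_br_gr : forall i j x y,
    x \in lla_gr i -> y \in lla_gr j -> lla_br x y \in lla_gr (i + j);
  lla_br_anti : forall x y, lla_br y x = - lla_br x y;
  lla_jacobi : forall i j k x y z,
    x \in lla_gr i -> y \in lla_gr j -> z \in lla_gr k ->
    local_degree (i + j) -> local_degree (j + k) -> local_degree (i + k) ->
    local_degree (i + j + k) ->
    lla_br x (lla_br y z) = lla_br (lla_br x y) z + lla_br y (lla_br x z)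
}.

Record lieAlgebra (K : fieldType) : Type := LieAlgebra {
  la_car :> lmodType K;
  la_br : la_car -> la_car -> la_car;
  la_br_linearl : forall y, linear (fun x => la_br x y);
  la_br_linearr : forall x, linear (la_br x);
  la_br_alt : forall x, la_br x x = 0;
  la_jacobi : forall x y z,
    la_br x (la_br y z) = la_br (la_br x y) z + la_br y (la_br x z)
}.

Definition subspace (K : fieldType) (V : lmodType K) (W : V -> Prop) : Prop :=
  W 0 /\ forall (a : K) (x y : V), W x -> W y -> W (a *: x + y).

Definition finite_dim (K : fieldType) (V : lmodType K) (W : V -> Prop) : Prop :=
  exists (d : nat) (e : 'I_d -> V),
    forall x, W x -> exists c : 'I_d -> K, x = \sum_(i < d) c i *: e i.

Definition lie_subalgebra (K : fieldType) (L : lieAlgebra K) (S : L -> Prop) :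
    Prop :=
  subspace S /\ forall x y, S x -> S y -> S (la_br x y).

Definition lie_ideal (K : fieldType) (L : lieAlgebra K) (J : L -> Prop) : Prop :=
  subspace J /\ forall x y, J y -> J (la_br x y).

Definition local_part_of (K : fieldType) (V : lmodType K)
    (gr : int -> V -> Prop) (x : V) : Prop :=
  exists a b c, [/\ gr (- 1) a, gr 0 b, gr 1 c & x = a + b + c].

Record gradedLieAlgebra (K : fieldType) : Type := GradedLieAlgebra {
  gla_lie :> lieAlgebra K;
  gla_gr : int -> gla_lie -> Prop;
  gla_gr_subspace : forall i, subspace (gla_gr i);
  gla_gr_sum : forall x, exists (s : seq int) (f : int -> gla_lie),
    (forall i, gla_gr i (f i)) /\ x = \sum_(i <- s) f i;
  gla_gr_direct : forall (s : seq int) (f : int -> gla_lie),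
    uniq s -> (forall i, gla_gr i (f i)) -> \sum_(i <- s) f i = 0 ->
    forall i, i \in s -> f i = 0;
  gla_gr_finite_dim : forall i, finite_dim (gla_gr i);
  gla_br_gr : forall i j x y,
    gla_gr i x -> gla_gr j y -> gla_gr (i + j) (la_br x y);
  gla_generated : forall S : gla_lie -> Prop,
    lie_subalgebra S -> (forall x, local_part_of gla_gr x -> S x) ->
    forall x, S x
}.

Definition local_part (K : fieldType) (L : gradedLieAlgebra K) : L -> Prop :=
  local_part_of (@gla_gr K L).

Definition graded_morphism (K : fieldType) (L M : gradedLieAlgebra K)
    (phi : {linear L -> M}) : Prop :=
  (forall i x, gla_gr i x -> gla_gr i (phi x)) /\
  (forall x y, phi (la_br x y) = la_br (phi x) (phi y)).

(* A morphism from Gamma to the local part of L, seen as a map into L. *)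
Definition local_morphism (K : fieldType) (Gamma : localLieAlgebra K)
    (L : gradedLieAlgebra K) (f : {linear Gamma -> L}) : Prop :=
  (forall i x, x \in lla_gr Gamma i -> gla_gr i (f x)) /\
  (forall i j x y, x \in lla_gr Gamma i -> y \in lla_gr Gamma j ->
     local_degree (i + j) -> f (lla_br x y) = la_br (f x) (f y)).

(* iota identifies Gamma with the local part of L. *)
Definition local_part_iso (K : fieldType) (Gamma : localLieAlgebra K)
    (L : gradedLieAlgebra K) (iota : {linear Gamma -> L}) : Prop :=
  [/\ local_morphism iota, injective iota &
      forall i y, local_degree i -> gla_gr i y ->
        exists2 x, x \in lla_gr Gamma i & iota x = y].

Definition is_gmax (K : fieldType) (Gamma : localLieAlgebra K)
    (gmax : gradedLieAlgebra K) (iota : {linear Gamma -> gmax}) : Prop :=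
  local_part_iso iota /\
  forall (L : gradedLieAlgebra K) (f : {linear Gamma -> L}),
    local_morphism f ->
    exists phi : {linear gmax -> L},
      [/\ graded_morphism phi, forall x, phi (iota x) = f x &
          forall psi : {linear gmax -> L}, graded_morphism psi ->
            (forall x, psi (iota x) = f x) -> forall z, psi z = phi z].

Definition graded_ideal (K : fieldType) (L : gradedLieAlgebra K)
    (J : L -> Prop) : Prop :=
  lie_ideal J /\
  forall x, J x -> exists (s : seq int) (f : int -> L),
    (forall i, gla_gr i (f i) /\ J (f i)) /\ x = \sum_(i <- s) f i.

Definition local_free_ideal (K : fieldType) (L : gradedLieAlgebra K)
    (J : L -> Prop) : Prop :=
  graded_ideal J /\ forall x, J x -> local_part x -> x = 0.

Definition is_Jmax (K : fieldType) (L : gradedLieAlgebra K)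
    (J : L -> Prop) : Prop :=
  local_free_ideal J /\
  forall I : L -> Prop, local_free_ideal I ->
    (forall x, J x -> I x) -> forall x, I x -> J x.

(* gmin is the quotient gmax / Jmax: there is a surjective morphism of graded
   Lie algebras pi : gmax -> gmin with kernel Jmax. *)
Definition is_gmin (K : fieldType) (Gamma : localLieAlgebra K)
    (gmin : gradedLieAlgebra K) : Prop :=
  exists (gmax : gradedLieAlgebra K) (iota : {linear Gamma -> gmax})
         (J : gmax -> Prop) (pi : {linear gmax -> gmin}),
    [/\ is_gmax iota, is_Jmax J, graded_morphism pi,
        forall y, exists x, pi x = y &
        forall x, pi x = 0 <-> J x].

(* The free Lie algebra on V is the quotient of [lie_term K V] by [lie_eq]. *)
Inductive lie_term (K : fieldType) (V : Type) : Type :=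
| LVar of V
| LZero
| LAdd of lie_term K V & lie_term K V
| LScale of K & lie_term K V
| LBr of lie_term K V & lie_term K V.

Arguments LVar {K V} _.
Arguments LZero {K V}.
Arguments LAdd {K V} _ _.
Arguments LScale {K V} _ _.
Arguments LBr {K V} _ _.

Inductive lie_eq (K : fieldType) (V : Type) :
    lie_term K V -> lie_term K V -> Prop :=
| lieq_refl t : lie_eq t t
| lieq_sym t u : lie_eq t u -> lie_eq u t
| lieq_trans t u v : lie_eq t u -> lie_eq u v -> lie_eq t v
| lieq_cadd t t' u u' : lie_eq t t' -> lie_eq u u' ->
    lie_eq (LAdd t u) (LAdd t' u')
| lieq_cscale a t t' : lie_eq t t' -> lie_eq (LScale a t) (LScale a t')
| lieq_cbr t t' u u' : lie_eq t t' -> lie_eq u u' ->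
    lie_eq (LBr t u) (LBr t' u')
| lieq_addA t u v : lie_eq (LAdd t (LAdd u v)) (LAdd (LAdd t u) v)
| lieq_addC t u : lie_eq (LAdd t u) (LAdd u t)
| lieq_add0 t : lie_eq (LAdd LZero t) t
| lieq_addN t : lie_eq (LAdd (LScale (- 1) t) t) LZero
| lieq_scaleA a b t : lie_eq (LScale a (LScale b t)) (LScale (a * b) t)
| lieq_scale1 t : lie_eq (LScale 1 t) t
| lieq_scaleDr a t u :
    lie_eq (LScale a (LAdd t u)) (LAdd (LScale a t) (LScale a u))
| lieq_scaleDl a b t :
    lie_eq (LScale (a + b) t) (LAdd (LScale a t) (LScale b t))
| lieq_brDl t u v : lie_eq (LBr (LAdd t u) v) (LAdd (LBr t v) (LBr u v))
| lieq_brDr t u v : lie_eq (LBr t (LAdd u v)) (LAdd (LBr t u) (LBr t v))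
| lieq_brZl a t u : lie_eq (LBr (LScale a t) u) (LScale a (LBr t u))
| lieq_brZr a t u : lie_eq (LBr t (LScale a u)) (LScale a (LBr t u))
| lieq_alt t : lie_eq (LBr t t) LZero
| lieq_jacobi t u v :
    lie_eq (LBr t (LBr u v)) (LAdd (LBr (LBr t u) v) (LBr u (LBr t v))).

Inductive lie_monomial (V : Type) : Type :=
| MVar of V
| MBr of lie_monomial V & lie_monomial V.

Arguments MVar {V} _.
Arguments MBr {V} _ _.

Fixpoint term_of_monomial (K : fieldType) (V : Type) (U : lie_monomial V) :
    lie_term K V :=
  match U with
  | MVar v => LVar v
  | MBr U1 U2 => LBr (term_of_monomial K U1) (term_of_monomial K U2)
  end.

Definition lie_poly (K : fieldType) (V : Type) : Type :=
  seq (K * lie_monomial V).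

Definition term_of_poly (K : fieldType) (V : Type) (P : lie_poly K V) :
    lie_term K V :=
  foldr (fun cU t => LAdd (LScale cU.1 (term_of_monomial K cU.2)) t) LZero P.

Fixpoint monomial_degree (V : Type) (d : V -> int) (U : lie_monomial V) : int :=
  match U with
  | MVar v => d v
  | MBr U1 U2 => monomial_degree d U1 + monomial_degree d U2
  end.

(* Every iterated sub-bracket of U, including U itself, has degree -1, 0 or 1. *)
Fixpoint locally_defined (V : Type) (d : V -> int) (U : lie_monomial V) : bool :=
  local_degree (monomial_degree d U) &&
  match U with
  | MVar _ => true
  | MBr U1 U2 => locally_defined d U1 && locally_defined d U2
  end.

(* The variables of P_n: [inl j] is the j-th of the first n - 1 variables
   Y_1, ..., Y_(n-1), [inr i] the i-th of the last n variables X_1, ..., X_n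
   (indices are shifted down by 1). *)
Definition Pvar (n : nat) : Type := ('I_n.-1 + 'I_n)%type.

Definition Pvar_degree (n : nat) (v : Pvar n) : int :=
  match v with inl _ => - 1 | inr _ => 1 end.

Fixpoint right_normed (K : fieldType) (V : Type) (s : seq V) : lie_term K V :=
  match s with
  | [::] => LZero
  | [:: v] => LVar v
  | v :: s' => LBr (LVar v) (right_normed K s')
  end.

(* [Y_1, [Y_2, [..., [Y_(n-1), [X_1, [..., [X_(n-1), X_n]...] *)
Definition YX_monomial (K : fieldType) (n : nat) : lie_term K (Pvar n) :=
  right_normed K ([seq inl j | j <- enum 'I_n.-1] ++
                  [seq inr i | i <- enum 'I_n]).

(* P is an admissible choice of the universal Lie polynomial P_n. *)
Definition is_calP (K : fieldType) (n : nat) (P : lie_poly K (Pvar n)) : Prop :=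
  lie_eq (YX_monomial K n) (term_of_poly P) /\
  all (fun cU => locally_defined (@Pvar_degree n) cU.2) P.

Fixpoint eval_monomial (K : fieldType) (Gamma : localLieAlgebra K) (V : Type)
    (v : V -> Gamma) (U : lie_monomial V) : Gamma :=
  match U with
  | MVar w => v w
  | MBr U1 U2 => lla_br (eval_monomial v U1) (eval_monomial v U2)
  end.

Definition eval_poly (K : fieldType) (Gamma : localLieAlgebra K) (V : Type)
    (v : V -> Gamma) (P : lie_poly K V) : Gamma :=
  \sum_(cU <- P) cU.1 *: eval_monomial v cU.2.

(* P(A_1, ..., A_(n-1), B_1, ..., B_n) = 0 for all A_j in g_p, B_i in g_q. *)
Definition P_identity (K : fieldType) (Gamma : localLieAlgebra K) (p q : int)
    (n : nat) (P : lie_poly K (Pvar n)) : Prop :=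
  forall (A : 'I_n.-1 -> Gamma) (B : 'I_n -> Gamma),
    (forall j, A j \in lla_gr Gamma p) -> (forall i, B i \in lla_gr Gamma q) ->
    eval_poly (fun w : Pvar n => match w with inl j => A j | inr i => B i end) P
    = 0.

(* Main.v *)
Require Import Defs.
From HB Require Import structures.
From mathcomp Require Import all_boot all_order all_algebra.
From mathcomp Require Import zify.
From mathcomp Require Import complex reals.

Set Implicit Arguments.
Unset Strict Implicit.
Unset Printing Implicit Defensive.

Import Order.TTheory GRing.Theory Num.Theory.
Local Open Scope ring_scope.

(** Write [g] for the minimal graded Lie algebra and [ad y] for the bracket with
    [y].  The theorem rests on two facts about [g], both symmetric under the
    exchange of positive and negative degrees; a sign [e] in {1, -1} treats the
    two cases at once.

    Generation ([gr_span_iterated_br]): since the local part generates [g], the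
    space [g_(e n)], [n >= 1], is spanned by the right-normed brackets of [n]
    elements of [g_e].  In particular, if they vanish for one [n] then they
    vanish for all larger ones.

    Transitivity ([gmin_transitive]): an element [x] of [g_(e n)] such that
    [ad y_1 ... ad y_(n-1) x = 0] for all [y_j] in [g_(-e)] is zero.
    Indeed, the elements with this property span a graded ideal that meets the
    local part trivially, and the quotient by [Jmax] leaves no such ideal but 0.

    On the other hand, the universal polynomial equals the monomial
    [[Y_1, ..., [Y_(n-1), [X_1, ..., X_n]]]] in the free Lie algebra, and it is
    evaluated in [g] exactly as in [Gamma], because the local part of [g] is
    [Gamma].  So the identity says that [n - 1] lowering brackets kill every
    right-normed bracket of [n] elements of [g_e] ([P_identityP]); by
    transitivity and generation this means that [g_(e i) = 0] for all [i >= n].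

    The last equivalence follows: all [g_i] are finite-dimensional, so [g] is
    finite-dimensional exactly when its degrees are bounded on both sides. *)

(** * Subspaces and sums of graded pieces *)

Section Subspaces.
Variables (K : fieldType) (V : lmodType K).
Implicit Types (W E : V -> Prop) (x y : V).

Lemma subspaceD W x y : subspace W -> W x -> W y -> W (x + y).
Proof. by move=> [_ WD] Wx Wy; rewrite -[x]scale1r; apply: WD. Qed.

Lemma subspaceZ W a x : subspace W -> W x -> W (a *: x).
Proof. by move=> [W0 WD] Wx; rewrite -[_ *: _]addr0; apply: WD. Qed.

Lemma subspaceB W x y : subspace W -> W x -> W y -> W (x - y).
Proof.
by move=> sW Wx Wy; rewrite -scaleN1r; apply: subspaceD => //; apply: subspaceZ.
Qed.

Lemma subspace_sum W (I : eqType) (s : seq I) (F : I -> V) :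
  subspace W -> (forall i, i \in s -> W (F i)) -> W (\sum_(i <- s) F i).
Proof.
move=> sW WF; rewrite big_seq; elim/big_rec: _ => [|i y i_s Wy].
  by case: sW.
by apply: subspaceD => //; apply: WF.
Qed.

Lemma subspace_preim (U : lmodType K) (f : U -> V) W :
  linear f -> subspace W -> subspace (fun u => W (f u)).
Proof.
move=> linf [W0 WD]; split=> [|a u v Wu Wv]; last by rewrite linf; apply: WD.
by have := linf (- 1) 0 0; rewrite !scaleN1r !addNr => ->.
Qed.

Lemma subspace_zero : subspace (fun x : V => x = 0).
Proof. by split=> // a x y -> ->; rewrite scaler0 addr0. Qed.

Lemma subspaceI (W1 W2 : V -> Prop) :
  subspace W1 -> subspace W2 -> subspace (fun x => W1 x /\ W2 x).
Proof. by case=> [? WD1] [? WD2]; split=> // a x y [? ?] [? ?]; auto. Qed.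

Lemma subspace_forall (I : Type) (D : I -> Prop) (W : I -> V -> Prop) :
  (forall i, D i -> subspace (W i)) ->
  subspace (fun x => forall i, D i -> W i x).
Proof.
move=> sW; split=> [i /sW[] //|a x y Wx Wy i Di].
by have [_] := sW i Di; apply; auto.
Qed.

(** Defined as an intersection, so that membership is itself an induction
    principle on the span. *)
Definition linspan E x :=
  forall W : V -> Prop, subspace W -> (forall y, E y -> W y) -> W x.

Lemma linspan_gen E x : E x -> linspan E x.
Proof. by move=> Ex W _; apply. Qed.

Lemma subspace_linspan E : subspace (linspan E).
Proof.
split=> [W [] //|a x y Ex Ey W sW EW].
by have [_] := sW; apply; [apply: Ex|apply: Ey].
Qed.

(** The sum of the [N i]; the duplicate-free support makes [f i] the actual
    component of degree [i] when [N] is contained in a grading. *)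
Definition gsum (N : int -> V -> Prop) x :=
  exists (s : seq int) (f : int -> V),
    [/\ uniq s, forall i, N i (f i) & x = \sum_(i <- s) f i].

(** Padding by zero lets two decompositions with different supports be compared
    or added over a common duplicate-free support. *)
Lemma big_extend_uniq (s t : seq int) (f : int -> V) :
  uniq s -> uniq t -> {subset s <= t} ->
  \sum_(i <- s) f i = \sum_(i <- t) if i \in s then f i else 0.
Proof.
move=> us ut st; rewrite -big_mkcond -[in RHS]big_filter.
apply: perm_big; apply: uniq_perm => //; first exact: filter_uniq.
by move=> i; rewrite mem_filter; apply/idP/andP => [is_|[]//]; rewrite is_ st.
Qed.

Lemma gsum_homog (N : int -> V -> Prop) i x :
  (forall j, subspace (N j)) -> N i x -> gsum N x.
Proof.
move=> sN Nx; exists [:: i], (fun j => if j == i then x else 0).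
split=> // [j|]; last by rewrite big_seq1 eqxx.
by case: eqP => [->|_] //; case: (sN j).
Qed.

Lemma subspace_gsum (N : int -> V -> Prop) :
  (forall j, subspace (N j)) -> subspace (gsum N).
Proof.
move=> sN; split; first by apply: (@gsum_homog _ 0) => //; case: (sN 0).
move=> a x y [s [f [us Nf ->]]] [t [g [ut Ng ->]]].
have uu := undup_uniq (s ++ t).
exists (undup (s ++ t)), (fun i => a *: (if i \in s then f i else 0)
                                 + if i \in t then g i else 0).
split=> // [i|].
  have [N0 _] := sN i; apply: subspaceD => //; first apply: subspaceZ => //.
    by case: ifP.
  by case: ifP.
rewrite big_split /= -scaler_sumr -!big_extend_uniq //.
  by move=> i it; rewrite mem_undup mem_cat it orbT.
by move=> i is_; rewrite mem_undup mem_cat is_.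
Qed.

End Subspaces.

(** * Ideals and generation in a graded Lie algebra *)

Section GradedLie.
Variables (K : fieldType) (L : gradedLieAlgebra K).
Implicit Types (x y z : L) (W : L -> Prop) (N : int -> L -> Prop).

Local Notation gr := (@gla_gr K L).

Lemma gla_gsum x : gsum gr x.
Proof.
have [s [f [grf ->]]] := gla_gr_sum x.
apply: subspace_sum => [|i _]; first exact/subspace_gsum/gla_gr_subspace.
by apply: (gsum_homog (i := i)) => //; apply: gla_gr_subspace.
Qed.

(** Directness of the grading: the difference of the two decompositions of the
    same vector is a vanishing sum of homogeneous terms. *)
Lemma gsum_component N (s : seq int) (f : int -> L) :
    (forall i, subspace (N i)) -> (forall i x, N i x -> gr i x) ->
    uniq s -> (forall i, gr i (f i)) -> gsum N (\sum_(i <- s) f i) ->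
  forall i, i \in s -> N i (f i).
Proof.
move=> sN Ngr us grf [t [g [ut Ng eq_fg]]] i is_.
have uu := undup_uniq (s ++ t).
have gr0 j : gr j 0 by case: (@gla_gr_subspace K L j).
pose h j := (if j \in s then f j else 0) - (if j \in t then g j else 0).
have sum_h : \sum_(j <- undup (s ++ t)) h j = 0.
  rewrite big_split /= sumrN -!big_extend_uniq ?eq_fg ?subrr //.
    by move=> j jt; rewrite mem_undup mem_cat jt orbT.
  by move=> j js; rewrite mem_undup mem_cat js.
have grh j : gr j (h j).
  apply: subspaceB; first exact: gla_gr_subspace.
    by case: ifP.
  by case: ifP => // _; apply/Ngr.
have := gla_gr_direct uu grh sum_h (i := i).
rewrite mem_undup mem_cat is_ => /(_ isT)/eqP; rewrite subr_eq0 is_ => /eqP->.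
by case: ifP => // _; case: (sN i).
Qed.

Lemma gsum_homog_inv N i x :
    (forall i, subspace (N i)) -> (forall i x, N i x -> gr i x) ->
  gr i x -> gsum N x -> N i x.
Proof.
move=> sN Ngr grx Nx.
have := @gsum_component N [:: i] (fun j => if j == i then x else 0) sN Ngr isT.
rewrite big_seq1 eqxx => /(_ _ Nx i); rewrite eqxx mem_seq1 eqxx; apply=> //.
by move=> j; case: eqP => [->|_] //; case: (@gla_gr_subspace K L j).
Qed.

Lemma subspace_brr W x : subspace W -> subspace (fun y => W (la_br x y)).
Proof. exact/subspace_preim/la_br_linearr. Qed.

Lemma subspace_brl W y : subspace W -> subspace (fun x => W (la_br x y)).
Proof. exact/(subspace_preim (la_br_linearl y)). Qed.

Lemma bracket0 x : la_br x 0 = 0.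
Proof. by case: (subspace_brr x (subspace_zero L)). Qed.

Lemma linspan_br (E F : L -> Prop) x :
  (forall y, E y -> linspan F (la_br x y)) ->
  forall y, linspan E y -> linspan F (la_br x y).
Proof.
move=> EF y Ey; apply: (Ey (fun z => linspan F (la_br x z))) => //.
exact/subspace_brr/subspace_linspan.
Qed.

(** The elements whose bracket stabilises [W] form a subalgebra by the Jacobi
    identity, and the local part generates the whole algebra. *)
Lemma local_stable_ideal W :
    subspace W ->
    (forall i x y, local_degree i -> gr i x -> W y -> W (la_br x y)) ->
  lie_ideal W.
Proof.
move=> sW locW; split=> // x y; move: x y.
apply: gla_generated => [|x [a [b [c [gra grb grc ->]]]] y Wy].
  split=> [|x y Wx Wy z Wz].
    by apply: subspace_forall => y _; apply: subspace_brl.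
  have -> : la_br (la_br x y) z = la_br x (la_br y z) - la_br y (la_br x z).
    by rewrite [la_br x (la_br y z)]la_jacobi addrK.
  by apply: subspaceB => //; auto.
have sW' := subspace_brl y sW.
apply: (subspaceD sW'); first apply: (subspaceD sW').
- exact: locW gra Wy.
- exact: locW grb Wy.
- exact: locW grc Wy.
Qed.

(** Meant for [x] of degree [e * (k + 1)], which [k] brackets with [g_(-e)]
    bring down to degree [e]. *)
Fixpoint lowering_null (e : int) k x : Prop :=
  if k is k'.+1
  then forall y, gr (- e) y -> lowering_null e k' (la_br y x) else x = 0.

Lemma subspace_lowering_null e k : subspace (lowering_null e k).
Proof.
elim: k => [|k IHk] /=; first exact: subspace_zero.
by apply: subspace_forall => y _; apply: subspace_brr.
Qed.

Lemma lowering_null_gr0 e k u x :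
  gr 0 u -> lowering_null e k x -> lowering_null e k (la_br u x).
Proof.
move=> gru; elim: k x => [|k IHk] x /=.
  by move=> ->; exact: bracket0.
move=> nx y gry; rewrite la_jacobi.
apply: subspaceD; first exact: subspace_lowering_null; last by apply/IHk/nx.
by apply: nx; rewrite -[- e]addr0; apply: gla_br_gr.
Qed.

(** Moving [y] past [z] costs a bracket with [[y, z]] in [g_0], which is
    harmless by [lowering_null_gr0]. *)
Lemma lowering_null_raise e k z x :
  gr e z -> lowering_null e k x -> lowering_null e k.+1 (la_br z x).
Proof.
move=> grz; elim: k x => [|k IHk] x nx y gry.
  by rewrite nx /= !bracket0.
change (lowering_null e k.+1 (la_br y (la_br z x))); rewrite la_jacobi.
apply: (subspaceD (subspace_lowering_null e k.+1)).
  by apply: lowering_null_gr0 => //; rewrite -(addNr e); apply: gla_br_gr.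
exact: (IHk _ (nx y gry)).
Qed.

Lemma lowering_null_leq e k l x :
  (k <= l)%N -> lowering_null e k x -> lowering_null e l x.
Proof.
elim: l k x => [|l IHl] [|k] x //= le_kl; last by move=> nx y /nx; apply: IHl.
by move=> -> y _; rewrite bracket0; apply: (IHl 0%N).
Qed.

Definition unit_degree (e : int) := e = 1 \/ e = - 1.

(** The elements of [g_i] killed when brought down to degree [e].  The condition
    [e * i <= k.+1] is uniform in [i]: for [e * i <= 1] it forces [x = 0], and
    for [e * i = m.+1] it amounts to [k = m] by [lowering_null_leq]. *)
Definition null_component e i x :=
  gr i x /\ forall k : nat, e * i <= k.+1%:Z -> lowering_null e k x.

Lemma subspace_null_component e i : subspace (null_component e i).
Proof.
apply: subspaceI; first exact: gla_gr_subspace.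
by apply: subspace_forall => k _; apply: subspace_lowering_null.
Qed.

Lemma null_component_local e i x :
  unit_degree e -> local_degree i -> null_component e i x -> x = 0.
Proof.
move=> ue; rewrite /local_degree => li [_ /(_ 0%N)]; apply.
by case: ue => ->; lia.
Qed.

(** Brackets with [g_(-e)], [g_0] and [g_e] respectively shorten, preserve and
    lengthen the number of lowering brackets that kill [y]; each matches the
    change of degree. *)
Lemma null_component_br e i j x y :
    unit_degree e -> local_degree i -> gr i x -> null_component e j y ->
  null_component e (i + j) (la_br x y).
Proof.
rewrite /local_degree => ue li grx [gry ny]; split; first exact: gla_br_gr.
move=> k lek; have [i0|[ie|ie]] : i = 0 \/ i = - e \/ i = e.
- by case: ue => ->; lia.
- by subst i; apply: lowering_null_gr0 => //; apply: ny; lia.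
- have /ny : e * j <= k.+2%:Z by case: ue lek ie => -> lek ie; lia.
  by apply; rewrite -ie.
subst i; case: k lek => [|k] lek; last first.
  by apply: lowering_null_raise => //; apply: ny; case: ue lek => ->; lia.
have -> : y = 0 by apply: (ny 0%N); case: ue lek => ->; lia.
by rewrite bracket0; case: (subspace_lowering_null e 0).
Qed.

Lemma ideal_null_component e :
  unit_degree e -> lie_ideal (gsum (null_component e)).
Proof.
move=> ue; have sN := subspace_gsum (subspace_null_component e).
apply: local_stable_ideal => // i x y li grx [s [f [_ Nf ->]]].
have sN' := subspace_brr x sN.
apply: (subspace_sum sN') => j _.
apply: (gsum_homog (subspace_null_component e)).
exact: null_component_br ue li grx (Nf j).
Qed.

(** An element of nonlocal degree is detected by lowering it to degree [e].
    This is the property that singles out the minimal graded Lie algebra. *)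
Definition transitive_grading := forall e k x,
  unit_degree e -> gr (e * k.+1%:Z) x -> lowering_null e k x -> x = 0.

(** [k] is one less than the number of elements of [g_e] in the bracket, hence
    than the absolute value of its degree; this is also the number of lowering
    brackets in [lowering_null e k]. *)
Fixpoint iterated_br (e : int) k x : Prop :=
  if k is k'.+1
  then exists y z, [/\ gr e y, iterated_br e k' z & x = la_br y z] else gr e x.

Lemma iterated_br_gr e k x : iterated_br e k x -> gr (e * k.+1%:Z) x.
Proof.
elim: k x => [|k IHk] x /=; first by rewrite mulr1.
move=> [y [z [gry /IHk grz ->]]].
have -> : e * k.+2%:Z = e + e * k.+1%:Z by lia.
exact: gla_br_gr.
Qed.

Lemma iterated_br_gr0 e k u x :
  gr 0 u -> iterated_br e k x -> linspan (iterated_br e k) (la_br u x).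
Proof.
move=> gru; elim: k x => [|k IHk] x /=.
  by move=> grx; apply: linspan_gen => /=; rewrite -[e]add0r; apply: gla_br_gr.
move=> [y [z [gry rz ->]]]; rewrite la_jacobi.
apply: (subspaceD (subspace_linspan _)).
  apply: linspan_gen; exists (la_br u y), z; split=> //.
  by rewrite -[e]add0r; apply: gla_br_gr.
apply: (linspan_br _ (IHk z rz)) => t rt.
by apply: linspan_gen; exists y, t.
Qed.

(** Pushed inside the bracket by the Jacobi identity, [v] meets each factor in
    turn and makes it an element of [g_0], which [iterated_br_gr0] absorbs. *)
Lemma iterated_br_lower e k v x :
  gr (- e) v -> iterated_br e k.+1 x -> linspan (iterated_br e k) (la_br v x).
Proof.
move=> grv; elim: k x => [|k IHk] x [y [z [gry rz ->]]]; rewrite la_jacobi.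
  apply: (subspaceD (subspace_linspan _)).
    by apply: iterated_br_gr0 => //; rewrite -(addNr e); apply: gla_br_gr.
  apply: linspan_gen => /=; rewrite -[e]addr0 -(addNr e).
  by apply: gla_br_gr => //; apply: gla_br_gr.
apply: (subspaceD (subspace_linspan _)).
  by apply: iterated_br_gr0 => //; rewrite -(addNr e); apply: gla_br_gr.
apply: (linspan_br _ (IHk z rz)) => t rt.
by apply: linspan_gen; exists y, t.
Qed.

Definition g0_or_iterated_br x :=
  gr 0 x \/ exists e k, unit_degree e /\ iterated_br e k x.

Lemma linspan_g0_or_iterated_br e k x :
  unit_degree e -> linspan (iterated_br e k) x -> linspan g0_or_iterated_br x.
Proof.
move=> ue; apply=> [|y ry]; first exact: subspace_linspan.
by apply: linspan_gen; right; exists e, k.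
Qed.

(** Stability under [g_(-e)] is [iterated_br_lower]; the other two cases are
    [iterated_br_gr0] and the definition. *)
Lemma ideal_g0_or_iterated_br : lie_ideal (linspan g0_or_iterated_br).
Proof.
apply: local_stable_ideal => [|i x y]; first exact: subspace_linspan.
rewrite /local_degree => li grx; apply: linspan_br => {}y [gry|[e [k [ue ry]]]].
  have gri : gr i (la_br x y) by rewrite -(addr0 i); apply: gla_br_gr.
  apply: linspan_gen; have [i0|ui] : i = 0 \/ unit_degree i.
  - by rewrite /unit_degree; lia.
  - by left; rewrite -[X in gla_gr X]i0.
  - by right; exists i, 0%N.
have [i0|[ie|ie]] : i = 0 \/ i = - e \/ i = e by case: ue => ->; lia.
- apply: (linspan_g0_or_iterated_br ue); apply: iterated_br_gr0 ry.
  by rewrite -[X in gla_gr X]i0.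
- subst i; case: k ry => [|k] ry.
    by apply: linspan_gen; left; rewrite -(addNr e); apply: gla_br_gr.
  exact: linspan_g0_or_iterated_br ue (iterated_br_lower grx ry).
- subst i; apply: (linspan_g0_or_iterated_br (k := k.+1) ue).
  by apply: linspan_gen; exists x, y.
Qed.

Lemma g0_or_iterated_br_full x : linspan g0_or_iterated_br x.
Proof.
move: x; apply: gla_generated; first split; first exact: subspace_linspan.
  by move=> x y _ Sy; case: ideal_g0_or_iterated_br => _; apply.
move=> x [a [b [c [gra grb grc ->]]]].
have sS := subspace_linspan g0_or_iterated_br.
apply: (subspaceD sS); first apply: (subspaceD sS); apply: linspan_gen.
- by right; exists (-1), 0%N; split=> //; right.
- by left.
- by right; exists 1, 0%N; split=> //; left.
Qed.

(** The span of [g_0] and of all iterated brackets is an ideal containing the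
    local part, hence everything; each of its generators is homogeneous, so the
    component of degree [e * k.+1] only comes from brackets of that length. *)
Lemma gr_span_iterated_br e k x :
  unit_degree e -> gr (e * k.+1%:Z) x -> linspan (iterated_br e k) x.
Proof.
move=> ue grx.
(* The pair [ek] is determined by [i]: one span is prescribed per degree. *)
pose N i x := gr i x /\ forall ek, unit_degree ek.1 /\ i = ek.1 * ek.2.+1%:Z ->
  linspan (iterated_br ek.1 ek.2) x.
have sN i : subspace (N i).
  apply: subspaceI; first exact: gla_gr_subspace.
  by apply: subspace_forall => ek _; apply: subspace_linspan.
have: N (e * k.+1%:Z) x.
  apply: gsum_homog_inv => // [i y []//|].
  have := g0_or_iterated_br_full x; apply=> [|y]; first exact: subspace_gsum.
  case=> [gry|[e' [k' [ue' ry]]]].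
    apply: (gsum_homog (i := 0)) => //; split=> // -[e' k'] /= [ue'].
    by case: ue' => ->; lia.
  apply: (gsum_homog (i := e' * k'.+1%:Z)) => //; split.
    exact: iterated_br_gr.
  move=> [e2 k2] /= [ue2 eq_deg]; apply: linspan_gen.
  have [-> ->] // : e2 = e' /\ k2 = k'.
  by case: ue ue' ue2 eq_deg => _ [->|->] [->|->]; lia.
by case=> _ /(_ (e, k)); apply.
Qed.

End GradedLie.

(** * The minimal graded Lie algebra *)

Section GMin.
Variables (K : fieldType) (Gamma : localLieAlgebra K).
Variable gmin : gradedLieAlgebra K.

(** Any preimage may be replaced by its component of degree [i]. *)
Lemma graded_morphism_lift (L M : gradedLieAlgebra K) (pi : {linear L -> M}) :
    graded_morphism pi -> (forall y, exists x, pi x = y) ->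
  forall i y, gla_gr i y -> exists2 x, gla_gr i x & pi x = y.
Proof.
move=> [pi_gr _] pi_surj i y gry.
pose N j (z : M) := exists2 x, gla_gr j x & pi x = z.
apply: (@gsum_homog_inv _ _ N) => // [j|j z [x grx <-]|].
- have [gr0 grD] := @gla_gr_subspace K L j.
  split=> [|a u v [x grx <-] [x' grx' <-]].
    by exists 0 => //; apply: raddf0.
  by exists (a *: x + x'); [apply: grD | rewrite linearP].
- exact: pi_gr.
have [x <-] := pi_surj y; have [s [f [us grf ->]]] := gla_gsum x.
exists s, (fun j => pi (f j)); split=> // [j|]; first by exists (f j).
exact: raddf_sum.
Qed.

(** The composite of [iota] with the projection is injective because the kernel
    of the latter meets the local part trivially, and surjective onto degrees
    -1, 0 and 1 by [graded_morphism_lift]. *)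
Lemma gmin_local_part_iso :
  is_gmin Gamma gmin ->
  exists f : {linear Gamma -> gmin}, local_part_iso f.
Proof.
move=> [gmax [iota [J [pi [gmaxP [[_ locJ] _] piP pi_surj kerpi]]]]].
have [[[iota_gr iota_br] iota_inj iota_surj] _] := gmaxP.
have [pi_gr pi_br] := piP.
exists (pi \o iota); split; first split.
- by move=> i x /iota_gr /pi_gr.
- by move=> i j x y xi yj lij /=; rewrite (iota_br i j) // pi_br.
- move=> x y /= /eqP; rewrite -subr_eq0 -!raddfB => /eqP/kerpi Jxy.
  apply/eqP; rewrite -subr_eq0; apply/eqP/iota_inj; rewrite raddf0.
  apply: (locJ _ Jxy); have := memvf (x - y).
  rewrite -(lla_gr_sum Gamma).
  move=> /memv_addP[_ /memv_addP[a ga [b gb ->]] [c gc ->]].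
  exists (iota a), (iota b), (iota c).
  by split; rewrite ?raddfD //; apply: iota_gr.
- move=> i y li gry.
  have [z grz <-] := graded_morphism_lift piP pi_surj gry.
  by have [x xi <-] := iota_surj _ _ li grz; exists x.
Qed.

(** The elements killed by lowering span a graded ideal of [gmin] meeting the
    local part trivially.  Its preimage in [gmax] has the same two properties
    and contains [Jmax], so it is [Jmax] by maximality: the ideal is zero. *)
Lemma gmin_transitive : is_gmin Gamma gmin -> transitive_grading gmin.
Proof.
move=> [gmax [_ [J [pi [_ [[_ locJ] Jmax] piP pi_surj kerpi]]]]].
move=> e k x ue grx nx.
have [pi_gr pi_br] := piP.
have sN := @subspace_null_component _ gmin e.
have [sS SI] := @ideal_null_component _ gmin e ue.
have Sx : gsum (null_component e) x.
  apply: (gsum_homog (i := e * k.+1%:Z)) => //; split=> // l le_kl.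
  by apply: lowering_null_leq nx; case: ue le_kl => ->; lia.
have Ngr j (y : gmin) : null_component e j y -> gla_gr j y by case.
pose I z := gsum (null_component e) (pi z).
have I_free : local_free_ideal I.
  split; first split; first split.
  - exact: subspace_preim (fun a u v => linearP pi a u v) sS.
  - by move=> u v Iv; rewrite /I pi_br; apply: SI.
  - move=> z; have [s [f [us grf ->]]] := gla_gsum z.
    rewrite /I raddf_sum => Iz.
    have If := gsum_component sN Ngr us (fun j => pi_gr _ _ (grf j)) Iz.
    exists s, (fun j => if j \in s then f j else 0); split=> [j|].
      case: ifP => [js|_]; first by split=> //; exact: gsum_homog (If j js).
      rewrite raddf0; split; first by case: (@gla_gr_subspace _ gmax j).
      by case: sS.
    by rewrite big_seq [RHS]big_seq; apply: eq_bigr => j ->.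
  move=> z Iz locz; apply: locJ => //; apply/kerpi.
  have [a [b [c [gra grb grc def_z]]]] := locz.
  pose f (j : int) := if j == - 1 then a else if j == 0 then b
    else if j == 1 then c else 0.
  have grf j : gla_gr j (f j).
    rewrite /f; do 3![case: eqP => [->//|_]].
    by case: (@gla_gr_subspace _ gmax j).
  have eq_z : pi z = \sum_(j <- [:: - 1; 0; 1]) pi (f j).
    by rewrite def_z !big_cons big_nil addr0 addrA !raddfD.
  have := gsum_component sN Ngr _ (fun j => pi_gr _ _ (grf j)) _.
  move=> /(_ [:: - 1; 0; 1] isT); rewrite -eq_z => /(_ Iz) Nf.
  rewrite eq_z big_seq big1 // => j js.
  apply: null_component_local (Nf j js) => //.
  by move: js; rewrite !inE /local_degree; lia.
have [z def_x] := pi_surj x; rewrite -def_x; apply/kerpi.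
apply: (Jmax I) => // [y /kerpi Jy|]; last by rewrite /I def_x.
by rewrite /I Jy; case: sS.
Qed.

End GMin.

(** * Evaluation of Lie polynomials *)

Section FreeLie.
Variables (K : fieldType) (V : Type).

Fixpoint eval_term (L : lieAlgebra K) (v : V -> L) (t : lie_term K V) : L :=
  match t with
  | LVar w => v w
  | LZero => 0
  | LAdd t u => eval_term v t + eval_term v u
  | LScale a t => a *: eval_term v t
  | LBr t u => la_br (eval_term v t) (eval_term v u)
  end.

(** Evaluation factors through the free Lie algebra: identities between its
    elements hold in every Lie algebra. *)
Lemma eval_term_lie_eq (L : lieAlgebra K) (v : V -> L) t u :
  lie_eq t u -> eval_term v t = eval_term v u.
Proof.
have brD x y z : la_br (x + y) z = la_br x z + la_br y z :> L.
  by have := la_br_linearl z 1 x y; rewrite !scale1r.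
have Dbr x y z : la_br x (y + z) = la_br x y + la_br x z :> L.
  by have := la_br_linearr x 1 y z; rewrite !scale1r.
have br0 (z : L) : la_br 0 z = 0.
  by apply: (addIr (la_br 0 z)); rewrite -brD !add0r.
have Obr (z : L) : la_br z 0 = 0.
  by apply: (addIr (la_br z 0)); rewrite -Dbr !add0r.
elim=> /= *; rewrite ?scaler0 //; try congruence.
- exact: addrA.
- exact: addrC.
- exact: add0r.
- by rewrite scaleN1r addNr.
- exact: scalerA.
- exact: scale1r.
- exact: scalerDr.
- exact: scalerDl.
- by rewrite -[_ *: _]addr0 la_br_linearl br0 addr0.
- by rewrite -[_ *: _]addr0 la_br_linearr Obr addr0.
- exact: la_br_alt.
- exact: la_jacobi.
Qed.

Fixpoint nested_br (L : lieAlgebra K) (s : seq L) : L :=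
  match s with
  | [::] => 0
  | [:: x] => x
  | x :: s' => la_br x (nested_br s')
  end.

Lemma eval_right_normed (L : lieAlgebra K) (v : V -> L) s :
  eval_term v (right_normed K s) = nested_br [seq v w | w <- s].
Proof. by elim: s => // w s IHs; case: s IHs => //= w' s <-. Qed.

Lemma nested_br_cat (L : lieAlgebra K) (s t : seq L) :
  t != [::] -> nested_br (s ++ t) = foldr (@la_br K L) (nested_br t) s.
Proof.
by move=> tn0; elim: s => //= x [|y s] <- //=; case: t tn0.
Qed.

(** Local definedness puts every bracket of [U] among those preserved by a local
    morphism.  The factor [e] lets the two halves of the grading be
    exchanged. *)
Lemma eval_local_monomial (Gamma : localLieAlgebra K) (L : gradedLieAlgebra K)
    (f : {linear Gamma -> L}) (v : V -> Gamma) (d : V -> int) e U :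
    local_morphism f -> unit_degree e ->
    (forall w, v w \in lla_gr Gamma (e * d w)) -> locally_defined d U ->
  eval_monomial v U \in lla_gr Gamma (e * monomial_degree d U) /\
  f (eval_monomial v U) = eval_term (f \o v) (term_of_monomial K U).
Proof.
move=> [_ f_br] ue gr_v; elim: U => [w|U1 IH1 U2 IH2] //=.
move=> /andP[ldU /andP[/IH1[gr1 f1] /IH2[gr2 f2]]].
rewrite mulrDr; split; first exact: lla_br_gr.
rewrite -f1 -f2; apply: f_br gr1 gr2 _; rewrite -mulrDr.
by move: ldU; rewrite /local_degree; case: ue => ->; lia.
Qed.

Lemma eval_local_poly (Gamma : localLieAlgebra K) (L : gradedLieAlgebra K)
    (f : {linear Gamma -> L}) (v : V -> Gamma) (d : V -> int) e P :
    local_morphism f -> unit_degree e ->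
    (forall w, v w \in lla_gr Gamma (e * d w)) ->
    all (fun cU => locally_defined d cU.2) P ->
  f (eval_poly v P) = eval_term (f \o v) (term_of_poly P).
Proof.
move=> f_morph ue gr_v; rewrite /eval_poly.
elim: P => [|[a U] P IHP] /=; first by rewrite big_nil raddf0.
move=> /andP[ldU /IHP <-]; rewrite big_cons linearP.
by have [_ ->] := eval_local_monomial f_morph ue gr_v ldU.
Qed.

End FreeLie.

(** * The universal identity as a statement on iterated brackets *)

Section NestedBrackets.
Variables (K : fieldType) (L : gradedLieAlgebra K).

Lemma lowering_nullP e k (x : L) :
  lowering_null e k x <->
  forall A : 'I_k -> L, (forall j, gla_gr (- e) (A j)) ->
    foldr (@la_br K L) x [seq A j | j <- enum 'I_k] = 0.
Proof.
elim: k x => [|k IHk] x.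
  split=> [-> A _|/(_ (fun _ => 0))].
    by rewrite (size0nil (size_enum_ord 0)).
  by rewrite (size0nil (size_enum_ord 0)); apply; case.
split=> [nx A grA|nx y gry].
  rewrite enum_ordSr map_rcons foldr_rcons -map_comp.
  by have /IHk := nx _ (grA ord_max); apply => j; apply: grA.
apply/IHk => A grA.
pose A' j := if unlift ord_max j is Some i then A i else y.
have grA' j : gla_gr (- e) (A' j) by rewrite /A'; case: unlift.
have := nx A' grA'; rewrite enum_ordSr map_rcons foldr_rcons -map_comp.
have -> : A' ord_max = y by rewrite /A' unlift_none.
move=> nx'; rewrite -[RHS]nx'; congr foldr.
apply: eq_map => j /=; rewrite /A'.
have -> : widen_ord (leqnSn k) j = lift ord_max j.
  by apply/val_inj/esym/lift_max.
by rewrite liftK.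
Qed.

Lemma iterated_brP e k (x : L) :
  iterated_br e k x <-> exists2 B : 'I_k.+1 -> L, (forall i, gla_gr e (B i)) &
    x = nested_br [seq B i | i <- enum 'I_k.+1].
Proof.
elim: k x => [|k IHk] x.
  rewrite enum_ordSl (size0nil (size_enum_ord 0)) /=.
  by split=> [grx|[B grB ->] //]; exists (fun=> x).
have brS (C : 'I_k.+2 -> L) : nested_br [seq C i | i <- enum 'I_k.+2] =
    la_br (C ord0) (nested_br [seq C (lift ord0 i) | i <- enum 'I_k.+1]).
  by rewrite [enum 'I_k.+2]enum_ordSl map_cons -map_comp enum_ordSl.
split=> [[y [z [gry]]]|[B grB ->]].
  move=> /IHk[B grB ->] ->.
  exists (fun i => if unlift ord0 i is Some j then B j else y) => [i|].
    by case: unlift.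
  rewrite brS unlift_none; congr (la_br _ (nested_br _)).
  by apply: eq_map => i; rewrite liftK.
exists (B ord0), (nested_br [seq B (lift ord0 i) | i <- enum 'I_k.+1]).
by split=> //; apply/IHk; exists (fun i => B (lift ord0 i)).
Qed.

(** [P] and [[Y_1, ..., [Y_k, [X_1, ..., X_(k+1)]]]] agree in the free Lie
    algebra, and [P] can be evaluated in [Gamma] as well as in [L]; since
    [f] is injective, its vanishing in [Gamma] says that [k] lowering brackets
    kill every iterated bracket of [k + 1] elements of [g_e]. *)
Lemma P_identityP (Gamma : localLieAlgebra K) (f : {linear Gamma -> L}) e k
    (P : lie_poly K (Pvar k.+1)) :
    local_part_iso f -> unit_degree e -> is_calP P ->
  P_identity Gamma (- e) e P <->
  forall x : L, iterated_br e k x -> lowering_null e k x.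
Proof.
move=> [f_morph f_inj f_surj] ue [eqP locP].
have fP (A : 'I_k -> Gamma) (B : 'I_k.+1 -> Gamma) :
    (forall j, A j \in lla_gr Gamma (- e)) ->
    (forall i, B i \in lla_gr Gamma e) ->
    f (eval_poly (fun w : Pvar k.+1 =>
                    match w with inl j => A j | inr i => B i end) P)
  = foldr (@la_br K L) (nested_br [seq f (B i) | i <- enum 'I_k.+1])
      [seq f (A j) | j <- enum 'I_k].
  move=> grA grB.
  rewrite (eval_local_poly f_morph ue _ locP) => [|[j|i]] /=; first last.
  - by rewrite mulr1.
  - by rewrite mulrN1.
  rewrite -(eval_term_lie_eq _ eqP) eval_right_normed map_cat -!map_comp.
  rewrite nested_br_cat //.
  by rewrite -size_eq0 size_map -enumT size_enum_ord.
have lift_gr d (n : nat) (A : 'I_n -> L) : local_degree d ->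
    (forall j, gla_gr d (A j)) ->
  exists A' : 'I_n -> Gamma,
    forall j, A' j \in lla_gr Gamma d /\ f (A' j) = A j.
  move=> ld grA.
  apply: (fin_all_exists
    (P := fun j a => a \in lla_gr Gamma d /\ f a = A j)) => j.
  by have [a] := f_surj _ _ ld (grA j); exists a.
have [le lNe] : local_degree e /\ local_degree (- e).
  by rewrite /local_degree; case: ue => ->.
split=> [idP x /iterated_brP[B /(lift_gr _ _ _ le)[B' B'P] ->]|nr A B grA grB].
  apply/lowering_nullP => A /(lift_gr _ _ _ lNe)[A' A'P].
  have grA' j : A' j \in lla_gr Gamma (- e) by case: (A'P j).
  have grB' i : B' i \in lla_gr Gamma e by case: (B'P i).
  have := fP A' B' grA' grB'; rewrite idP // raddf0.
  rewrite (eq_map (fun j => (A'P j).2)) (eq_map (fun i => (B'P i).2)).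
  by move=> <-.
apply: f_inj; rewrite raddf0 fP //; have [f_gr _] := f_morph.
apply: (lowering_nullP e k _).1 => [|j]; last exact: f_gr.
by apply: nr; apply/iterated_brP; exists (f \o B) => // i; apply: f_gr.
Qed.

End NestedBrackets.

(** * Vanishing of high degrees and finite dimension *)

Section Vanishing.
Variables (K : fieldType) (L : gradedLieAlgebra K).

(** Transitivity turns [lowering_null] into vanishing for the iterated brackets
    of length [k + 1], hence for the longer ones that contain them, and these
    span all degrees from [k + 1] on. *)
Lemma gr_vanish_lowering_nullP e k :
    transitive_grading L -> unit_degree e ->
  (forall (i : int) (x : L), k.+1%:Z <= e * i -> gla_gr i x -> x = 0) <->
  (forall x : L, iterated_br e k x -> lowering_null e k x).
Proof.
move=> trL ue; split=> [van x rx|nr i x le_ki grx].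
  have -> : x = 0.
    apply: van (iterated_br_gr rx); case: ue => ->; lia.
  by case: (subspace_lowering_null L e k).
have gr0 (y : L) : iterated_br e k y -> y = 0.
  by move=> ry; apply: (trL e k) => //; [apply: iterated_br_gr | apply: nr].
have rn0 m (y : L) : iterated_br e (m + k) y -> y = 0.
  elim: m y => [|m IHm] y; first exact: gr0.
  by case=> [u [v [_ /IHm -> ->]]]; rewrite bracket0.
have [m def_i] : exists m : nat, i = e * (m + k)%N.+1%:Z.
  exists (`|(e * i)%R|%N - k.+1)%N; case: ue le_ki => ->; lia.
rewrite def_i in grx.
exact: (gr_span_iterated_br ue grx (subspace_zero L) (rn0 m)).
Qed.

(** Finitely many spanning vectors have finitely many nonzero components. *)
Lemma finite_dim_bounded :
  finite_dim (fun _ : L => True) ->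
  exists N : nat, forall i (x : L), (N < `|i|)%N -> gla_gr i x -> x = 0.
Proof.
move=> [d [b span_b]].
have /fin_all_exists[s sP] (l : 'I_d) : exists s : seq int, exists f : int -> L,
  [/\ uniq s, forall i, gla_gr i (f i) & b l = \sum_(i <- s) f i].
  by have [s [f fP]] := gla_gsum (b l); exists s, f.
pose N := (\max_(l < d) \max_(i <- s l) `|i|)%N.
exists N => i x ltNi grx.
pose W j (y : L) := gla_gr j y /\ ((N < `|j|)%N -> y = 0).
have sW j : subspace (W j).
  apply: subspaceI; first exact: gla_gr_subspace.
  by split=> [//|a u v u0 v0 ltNj]; rewrite u0 // v0 // scaler0 addr0.
suff: W i x by case=> _; apply.
apply: (gsum_homog_inv sW) => // [j y []//|].
have [c ->] := span_b x I; have sgW := subspace_gsum sW.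
apply: subspace_sum => // l _; apply: subspaceZ => //.
have [f [us grf ->]] := sP l.
apply: subspace_sum => // j js; apply: (gsum_homog (i := j)) => //; split=> //.
rewrite ltnNge /N (leq_trans _ (leq_bigmax l)) //.
exact: (leq_bigmax_seq (F := fun i : int => `|i|%N)).
Qed.

Lemma finite_dim_subspace_sum (V : lmodType K) (W1 W2 : V -> Prop) :
  finite_dim W1 -> finite_dim W2 ->
  finite_dim (fun x => exists x1 x2, [/\ W1 x1, W2 x2 & x = x1 + x2]).
Proof.
move=> [d1 [b1 span1]] [d2 [b2 span2]].
exists (d1 + d2)%N.
exists (fun l => match split l with inl i => b1 i | inr j => b2 j end).
move=> _ [x1 [x2 [/span1[c1 ->] /span2[c2 ->] ->]]].
exists (fun l => match split l with inl i => c1 i | inr j => c2 j end).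
rewrite big_split_ord /=; congr (_ + _); apply: eq_bigr => i _.
  by rewrite (unsplitK (inl _ i)).
by rewrite (unsplitK (inr _ i)).
Qed.

Lemma bounded_finite_dim (N : nat) :
  (forall i (x : L), (N < `|i|)%N -> gla_gr i x -> x = 0) ->
  finite_dim (fun _ : L => True).
Proof.
move=> van.
have fin_s (s : seq int) : finite_dim (fun x : L =>
    exists2 f, forall i, gla_gr i (f i) & x = \sum_(i <- s) f i).
  elim: s => [|j s [d [b span_b]]].
    exists 0%N, (fun _ => 0) => _ [f _ ->]; exists (fun _ => 0).
    by rewrite big_nil big_ord0.
  have [d' [b' span']] := finite_dim_subspace_sum (gla_gr_finite_dim L j)
    (ex_intro _ d (ex_intro _ b span_b)).
  exists d', b' => _ [f grf ->]; apply: span'; rewrite big_cons.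
  by exists (f j), (\sum_(i <- s) f i); split=> //; exists f.
have [r [ur mem_r]] : exists r : seq int,
    uniq r /\ forall i, (i \in r) = (`|i| <= N)%N.
  exists [seq l%:Z - N%:Z | l <- iota 0 (N + N).+1]; split.
    by rewrite map_inj_uniq ?iota_uniq // => l l'; lia.
  move=> i; apply/mapP/idP => [[l]|le_iN]; first by rewrite mem_iota; lia.
  by exists `|(i + N%:Z)%R|%N; rewrite ?mem_iota; lia.
have [d [b span_b]] := fin_s r; exists d, b => x _; apply: span_b.
have [s [f [us grf ->]]] := gla_gsum x.
exists (fun i => if i \in s then f i else 0) => [i|].
  by case: ifP => // _; case: (@gla_gr_subspace K L i).
rewrite [LHS](bigID (mem r)) /= [X in _ + X]big1_seq ?addr0 => [|i]; last first.
  by rewrite mem_r -ltnNge => /andP[ltNi _]; apply: van (grf i).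
rewrite -big_filter -big_mkcond -[RHS]big_filter; apply: perm_big.
by apply: uniq_perm; rewrite ?filter_uniq // => i; rewrite !mem_filter andbC.
Qed.

End Vanishing.

Lemma P_identity_vanish (K : fieldType) (Gamma : localLieAlgebra K)
    (gmin : gradedLieAlgebra K) e n (P : lie_poly K (Pvar n)) :
    is_gmin Gamma gmin -> unit_degree e -> (0 < n)%N -> is_calP P ->
  P_identity Gamma (- e) e P <->
  forall (i : int) (x : gmin), n%:Z <= e * i -> gla_gr i x -> x = 0.
Proof.
case: n P => // k P gminP ue _ calP.
have [f f_iso] := gmin_local_part_iso gminP.
rewrite (P_identityP f_iso ue calP) gr_vanish_lowering_nullP //.
exact: gmin_transitive gminP.
Qed.

Theorem theorem2p2p4 (R : realType) (Gamma : localLieAlgebra R[i])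
    (gmin : gradedLieAlgebra R[i]) (gmin_Gamma : is_gmin Gamma gmin)
    (P : forall n : nat, lie_poly R[i] (Pvar n))
    (P_calP : forall n : nat, (2 <= n)%N -> is_calP (P n)) :
  [/\ forall n : nat, (2 <= n)%N ->
        ((forall i : int, n%:Z <= i -> forall x : gmin, gla_gr i x -> x = 0)
         <-> P_identity Gamma (- 1) 1 (P n)),
      forall n : nat, (2 <= n)%N ->
        ((forall i : int, i <= - n%:Z -> forall x : gmin, gla_gr i x -> x = 0)
         <-> P_identity Gamma 1 (- 1) (P n)) &
      finite_dim (fun _ : gmin => True)
      <-> exists m n : nat,
            [/\ (2 <= m)%N, (2 <= n)%N, P_identity Gamma (- 1) 1 (P m) &
                P_identity Gamma 1 (- 1) (P n)]].
Proof.
have vanish e n : unit_degree e -> (2 <= n)%N ->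
    P_identity Gamma (- e) e (P n) <->
    forall (i : int) (x : gmin), n%:Z <= e * i -> gla_gr i x -> x = 0.
  move=> ue n2; apply: P_identity_vanish => //; first exact: ltnW.
  exact: P_calP.
have vanish1 n (n2 : (2 <= n)%N) := vanish 1 n (or_introl erefl) n2.
have vanishN1 n (n2 : (2 <= n)%N) := vanish (- 1) n (or_intror erefl) n2.
split=> [n /vanish1 vn|n /vanishN1|].
- rewrite vn; split=> van i => [x|].
    by rewrite mul1r => le_ni; apply: van.
  by move=> le_ni x; apply: van; rewrite mul1r.
- rewrite opprK => ->; split=> van i => [x le_ni|le_ni x].
    by apply: van; lia.
  by apply: van; lia.
split=> [/finite_dim_bounded[N van]|[m [n [m2 n2]]]].
  exists N.+2, N.+2; split=> //.
    by apply/vanish1 => // i x le_i; apply: van; lia.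
  rewrite -[X in P_identity _ X](opprK 1).
  by apply/vanishN1 => // i x le_i; apply: van; lia.
move=> /(vanish1 _ m2) van_up.
rewrite -[X in P_identity _ X](opprK 1) => /(vanishN1 _ n2) van_down.
apply: (@bounded_finite_dim _ _ (m + n)) => i x lt_i.
have [i0|i0] := lerP 0 i; [apply: van_up | apply: van_down]; lia.
Qed.
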